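(* Let $n$ be a positive integer with $n \neq 4$ and let $V$ be a set with exactly $n$ elements. Then there exists an anchor $A$ in $V$ with $|A| < \frac{7}{6}n^2$, where $|A|$ denotes the number of three-point subsets belonging to $A$.
   Context: Let $(V,\mathrm{dist})$ be a metric space. A triangle of $V$ is a three-point subset of $V$. A triangle is called degenerate if its points can be labeled as $r,s,t$ (pairwise distinct) so that $\mathrm{dist}(r,s)+\mathrm{dist}(s,t)=\mathrm{dist}(r,t)$; otherwise it is nondegenerate. Given a set $V$, a set $A$ of three-point subsets of $V$ is called an anchor in $V$ if, for every metric $\mathrm{dist}$ on $V$ such that all triangles in $A$ are degenerate in $(V,\mathrm{dist})$, the metric space $(V,\mathrm{dist})$ is isometric to a subset of the real line with the usual Euclidean metric. *)

(* Defs.v *)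
From mathcomp Require Import all_boot all_order all_algebra.
From mathcomp Require Import boolp classical_sets functions reals.

Set Implicit Arguments.
Unset Strict Implicit.
Unset Printing Implicit Defensive.

Import GRing.Theory Num.Theory.
Local Open Scope ring_scope.

(* The same axioms as the factory [isMetric] of MathComp-Analysis, unbundled so
   that one can quantify over all metrics on a fixed [V]; nonnegativity follows
   from the triangle inequality and symmetry. *)
Definition is_metric (R : realType) (V : Type) (dist : V -> V -> R) : Prop :=
  [/\ forall x y, dist x y = 0 <-> x = y,
      forall x y, dist x y = dist y x
    & forall x y z, dist x z <= dist x y + dist y z].

Definition triangle (V : finType) (T : {set V}) : Prop := #|T| = 3%N.

Definition degenerate (R : realType) (V : finType) (dist : V -> V -> R)
    (T : {set V}) : Prop :=
  exists r s t : V,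
    [/\ uniq [:: r; s; t], T = [set r; s; t]
      & dist r s + dist s t = dist r t].

Definition isometric_to_subset_of_line (R : realType) (V : Type)
    (dist : V -> V -> R) : Prop :=
  exists (S : set R) (f : V -> R),
    set_bij [set: V]%classic S f /\ forall x y, `|f x - f y| = dist x y.

Definition anchor (R : realType) (V : finType) (A : {set {set V}}) : Prop :=
  (forall T, T \in A -> triangle T) /\
  forall dist : V -> V -> R, is_metric dist ->
    (forall T, T \in A -> degenerate dist T) ->
    isometric_to_subset_of_line dist.
Arguments anchor R {V} A.

(* Main.v *)
Require Import Defs.
From mathcomp Require Import all_boot all_order all_algebra.
From mathcomp Require Import reals.
From mathcomp Require Import zify ring lra.

Import Order.TTheory GRing.Theory Num.Theory.

Local Open Scope ring_scope.

(** Fix two points [p] and [q] at distance [delta], and suppose that every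
    triangle containing [p] or [q] is degenerate. The triangle [p], [q], [x]
    puts [x] at a definite place [g x] of the line on which [p] sits at [0] and
    [q] at [delta] ([coordinate_sqr]). The triangle [p], [x], [y] says that the
    distance from [x] to [y] is that of [g x] to [g y] or to the mirror image of
    [g y] at [0]; the triangle [q], [x], [y] says the same with the mirror at
    [delta]. So a pair with the wrong distance, a bad pair, is mirrored to the
    same effect by both, which forces [g x + g y = delta] and makes the distance
    equal to [delta] as well ([frame_dichotomy]).

    One further degenerate triangle [x], [y], [z] excludes a bad pair [x], [y]
    ([frame_cover_line]). If [z] has the right distances to [x] and [y], then the
    distance from [x] to [y] is the right one or [|delta - 2 * g z|]; the latter
    equals [delta] only if [z] is [p] or [q]. If [z] also forms a bad pair with
    [x] or [y], then two of the three points share a coordinate or all three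
    distances are [delta], and both are impossible.

    Hence an anchor is formed by the triples that meet [p, q], about [n ^ 2] of
    them, together with any family of triples covering all pairs of the other
    [m = n - 2] points. In an abelian group of order [m], a pair [x], [y] lies in
    a triple with sum zero, the third point being [- (x + y)], unless
    [y = - 2 x] or [x = - 2 y]; at most [m] additional triples take care of these
    exceptions. Two zero-sum triples share at most one point, so there are at
    most [m (m - 1) / 6] of them ([pair_cover_group]). The total is below
    [7 n ^ 2 / 6]. The construction fails only for [m = 2], where the single
    remaining pair is in no triple; this is [n = 4]. *)

(** * Counting triples *)

Lemma card_set3 (T : finType) (x y z : T) :
  x != y -> x != z -> y != z -> #|[set x; y; z]| = 3%N.
Proof.
move=> xy xz yz; rewrite setUC cardsU1 !inE cards2 xy negb_or.
by rewrite ![z == _]eq_sym xz yz.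
Qed.

Lemma card_triples_at (T : finType) (p : T) :
  (#|[set A : {set T} | (#|A| == 3%N) && (p \in A)]| <= 'C(#|T|.-1, 2))%N.
Proof.
have inj : {in [set A : {set T} | (#|A| == 3%N) && (p \in A)] &,
    injective (fun A => A :\ p)}.
  move=> A B; rewrite !inE => /andP[_ pA] /andP[_ pB] AB.
  by rewrite -(setD1K pA) AB setD1K.
rewrite -(card_in_imset inj) -(cardsC1 p) -cards_draws.
apply/subset_leq_card/subsetP => _ /imsetP[A + ->].
rewrite !inE => /andP[/eqP A3 pA].
move: (cardsD1 p A); rewrite A3 pA add1n => -[<-]; rewrite eqxx andbT.
by apply/subsetP => x; rewrite !inE => /andP[].
Qed.

(** Double counting of the inclusions of a two-point set in a member of [C]: a
    member contains three two-point sets, and none of these is in another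
    member. *)
Lemma triple_packing_bound (T : finType) (C : {set {set T}}) :
    (forall A, A \in C -> #|A| = 3%N) ->
    {in C &, forall A B, (1 < #|A :&: B|)%N -> A = B} ->
  (3 * #|C| <= 'C(#|T|, 2))%N.
Proof.
move=> C3 Cpack.
have -> : (3 * #|C| =
    \sum_(A in C) \sum_(D : {set T} | (#|D| == 2%N) && (D \subset A)) 1)%N.
  rewrite mulnC -sum_nat_const; apply: eq_bigr => A AC.
  rewrite sum1_card -[LHS]/'C(3, 2)%N -(C3 _ AC) -cards_draws cardsE.
  by apply: eq_card => D; rewrite !unfold_in andbC.
rewrite (exchange_big_dep (fun D : {set T} => #|D| == 2%N)) /=; last first.
  by move=> A D _ /andP[].
rewrite -[leqRHS]/('C(#|T|, 2)) -card_draws cardsE -sum1_card.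
apply: leq_sum => D /eqP D2; rewrite sum1_card.
apply/card_le1_eqP => A B; rewrite !unfold_in.
move=> /and3P[AC _ DA] /and3P[BC _ DB]; apply: Cpack => //.
by rewrite -D2; apply: subset_leq_card; rewrite subsetI DA DB.
Qed.

(** * Covering pairs by triples *)

Definition covers_pairs {T : finType} (W : {set T}) (C : {set {set T}}) : Prop :=
  forall x y, x \in W -> y \in W -> x != y ->
  exists z, [/\ z \in W, z != x, z != y & [set x; y; z] \in C].

Definition zero_sum_triples (G : finZmodType) : {set {set G}} :=
  [set A : {set G} | (#|A| == 3%N) && (\sum_(x in A) x == 0)].

Lemma sum_set3 (G : finZmodType) (x y z : G) :
  x != y -> x != z -> y != z -> \sum_(u in [set x; y; z]) u = x + y + z.
Proof.
move=> xy xz yz; rewrite setUC big_setU1 ?big_setU1 ?big_set1 ?inE //=.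
  by rewrite addrC.
by rewrite negb_or ![z == _]eq_sym xz yz.
Qed.

(** Two points of a zero-sum triple determine the third. *)
Lemma zero_sum_triples_packing (G : finZmodType) :
  {in zero_sum_triples G &, forall A B, (1 < #|A :&: B|)%N -> A = B}.
Proof.
move=> A B; rewrite !inE => /andP[/eqP A3 /eqP A0] /andP[/eqP B3 /eqP B0].
move=> /card_gt1P[x [y [/setIP[xA xB] /setIP[yA yB] xy]]].
have third (S : {set G}) : #|S| = 3%N -> \sum_(u in S) u = 0 ->
    x \in S -> y \in S -> S = [set x; y; - (x + y)].
  move=> S3 S0 xS yS.
  have /cards1P[z Sz] : #|S :\ x :\ y| == 1%N.
    by move: S3; rewrite (cardsD1 x) (cardsD1 y) xS !inE eq_sym xy yS;
      rewrite !add1n => -[->].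
  have : z \in S :\ x :\ y by rewrite Sz set11.
  rewrite !inE ![z == _]eq_sym => /and3P[yz xz zS].
  have SE : S = [set x; y; z].
    by rewrite -(setD1K xS) -(@setD1K _ y (S :\ x)) ?Sz ?setUA // !inE eq_sym xy.
  move: S0; rewrite SE sum_set3 // => /eqP; rewrite addr_eq0 => /eqP.
  by move=> ->; rewrite opprK.
by rewrite (third A) // (third B).
Qed.

(** Dividing by three, the bound is the number [m (m - 1) / 6] of a Steiner triple
    system, up to the [m] triples [{x, - 2 x, f x}] for the pairs which no
    zero-sum triple covers. *)
Lemma pair_cover_group (G : finZmodType) : (2 < #|G|)%N ->
  exists C : {set {set G}}, [/\ forall A, A \in C -> #|A| = 3%N,
    covers_pairs [set: G] C & (3 * #|C| <= 'C(#|G|, 2) + 3 * #|G|)%N].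
Proof.
move=> G_gt2.
have /fin_all_exists[f fresh] (x : G) : exists z, z \notin [set x; - (x + x)].
  have /card_gt0P[z] : (0 < #|~: [set x; - (x + x)]|)%N.
    by rewrite cardsCs setCK cards2 subn_gt0; case: eqP => // _; apply: ltnW.
  by rewrite inE; exists z.
pose doubling_triples :=
  [set A in [set [set x; - (x + x); f x] | x in G] | #|A| == 3%N].
have doubling (x y : G) : x != y -> - (x + x) = y ->
    exists z, [/\ z != x, z != y & [set x; y; z] \in doubling_triples].
  move=> xy yE; have := fresh x; rewrite !inE yE negb_or => /andP[zx zy].
  exists (f x); split=> //; rewrite inE card_set3 ?[_ == f x]eq_sym // eqxx andbT.
  by apply/imsetP; exists x => //; rewrite yE.
exists (zero_sum_triples G :|: doubling_triples); split.
- by move=> A; rewrite !inE => /orP[] /andP[] => [/eqP|_ /eqP].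
- move=> x y _ _ xy.
  have [zx|zx] := eqVneq (- (x + y)) x.
    have [|z [zx' zy zD]] := doubling x y xy.
      by rewrite opprD -{2}zx opprK addKr.
    by exists z; split; rewrite ?in_setT // in_setU zD orbT.
  have [zy|zy] := eqVneq (- (x + y)) y.
    have [||z [zy' zx' zD]] := doubling y x; first by rewrite eq_sym.
      by rewrite opprD -{1}zy opprK addrK.
    by exists z; split; rewrite ?in_setT // (setUC [set x]) in_setU zD orbT.
  exists (- (x + y)); split; rewrite ?in_setT // in_setU inE.
  rewrite eq_sym in zx; rewrite eq_sym in zy.
  by rewrite card_set3 ?sum_set3 // eqxx subrr eqxx.
- have zero_le : (3 * #|zero_sum_triples G| <= 'C(#|G|, 2))%N.
    apply: triple_packing_bound; last exact: zero_sum_triples_packing.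
    by move=> A; rewrite inE => /andP[/eqP].
  have doubling_le : (#|doubling_triples| <= #|G|)%N.
    apply: leq_trans (leq_imset_card (fun x => [set x; - (x + x); f x]) G).
    by apply/subset_leq_card/subsetP => A; rewrite inE => /andP[].
  have [/(leq_mul (leqnn 3))/leq_trans] :=
    leq_card_setU (zero_sum_triples G) doubling_triples.
  by move=> + _; apply; rewrite mulnDr leq_add // leq_mul2l.
Qed.

(** Sets with at most one point have no pair to cover; larger ones are labelled by
    a cyclic group. *)
Lemma pair_cover_exists (T : finType) (W : {set T}) : #|W| != 2%N ->
  exists C : {set {set T}}, [/\ forall A, A \in C -> #|A| = 3%N,
    covers_pairs W C & (3 * #|C| <= 'C(#|W|, 2) + 3 * #|W|)%N].
Proof.
move=> W2; have [W1|W_gt1] := leqP #|W| 1%N.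
  exists set0; split=> [A|x y xW yW|]; rewrite ?inE ?cards0 //.
  by rewrite (card_le1_eqP W1 x y xW yW) eqxx.
have : (2 < #|W|)%N by lia.
case cardW: #|W| => [|m] // m_gt1.
have [|C [C3 Ccov Cle]] := @pair_cover_group 'I_m.+1; first by rewrite card_ord.
pose e (i : 'I_m.+1) := enum_val (cast_ord (esym cardW) i).
have e_inj : injective e by move=> i j /enum_val_inj/cast_ord_inj.
have eW i : e i \in W by apply: enum_valP.
have e_surj x : x \in W -> exists i, x = e i.
  move=> xW; exists (cast_ord cardW (enum_rank_in xW x)).
  by rewrite /e cast_ordK enum_rankK_in.
exists [set e @: (A : {set 'I_m.+1}) | A in C]; split.
- by move=> _ /imsetP[A AC ->]; rewrite card_imset // C3.
- move=> _ _ /e_surj[i ->] /e_surj[j ->]; rewrite (inj_eq e_inj) => ij.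
  have [k [_ ki kj kC]] := Ccov i j (in_setT _) (in_setT _) ij.
  exists (e k); split; rewrite ?(inj_eq e_inj) //.
  by apply/imsetP; exists [set i; j; k] => //; rewrite !imsetU !imset_set1.
- move: Cle; rewrite card_ord; apply: leq_trans.
  by rewrite leq_mul2l leq_imset_card orbT.
Qed.

(** * Degenerate triangles and coordinates *)

Section MetricLine.
Set Implicit Arguments.
Unset Strict Implicit.
Variables (R : realType) (V : finType) (d : V -> V -> R).
Hypothesis d_metric : is_metric d.

Lemma dist_sym x y : d x y = d y x. Proof. by case: d_metric. Qed.

Lemma dist_refl x : d x x = 0. Proof. by case: d_metric => /(_ x x) [_ ->]. Qed.

Lemma dist_eq0 x y : d x y = 0 -> x = y.
Proof. by case: d_metric => /(_ x y) []. Qed.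

Lemma dist_ge0 x y : 0 <= d x y.
Proof.
case: d_metric => _ _ /(_ x y x); rewrite dist_refl (dist_sym y x); lra.
Qed.

Lemma dist_gt0 x y : x != y -> 0 < d x y.
Proof.
by move=> xy; rewrite lt0r dist_ge0 andbT; apply: contraNneq xy => /dist_eq0 ->.
Qed.

Lemma coordinate_isometric (f : V -> R) :
  (forall x y, `|f x - f y| = d x y) -> isometric_to_subset_of_line d.
Proof.
move=> fd; exists (classical_sets.image classical_sets.setT f), f; split=> //.
split => [x|x y _ _ fxy|_ [x _ <-]]; [by exists x| |by exists x].
by apply: dist_eq0; rewrite -fd fxy subrr normr0.
Qed.

(** Which of the three points lies between the other two depends on the
    labelling hidden in [degenerate]; this spells out the possibilities for a
    given labelling. *)
Lemma degenerate_set3 x y z : degenerate d [set x; y; z] ->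
  [\/ d x y + d y z = d x z, d x y + d x z = d y z | d x z + d y z = d x y].
Proof.
move=> [r [s [t [rst E e]]]].
have : [&& r \in [set x; y; z], s \in [set x; y; z] & t \in [set x; y; z]].
  by rewrite E !inE !eqxx !orbT.
move: rst e; rewrite /= !inE negb_or andbT => /andP[/andP[rs rt] st] e.
rewrite -!orbA => /and3P[/or3P[]/eqP ? /or3P[]/eqP ? /or3P[]/eqP ?]; subst;
  try (by rewrite eqxx in rs rt st);
  move: (dist_sym x y) (dist_sym y z) (dist_sym x z) e.
all: try by move=> *; constructor 1; lra.
all: try by move=> *; constructor 2; lra.
all: try by move=> *; constructor 3; lra.
Qed.

(** If [x] and [y] are at places [a] and [b] relative to [o], then their distance
    is that of [a] to [b] or to [- b]. Squares absorb the signs of [a], [b] and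
    of the differences, so no absolute values have to be split. *)
Lemma degenerate_sqr_dist o x y (a b : R) : degenerate d [set o; x; y] ->
    d o x ^+ 2 = a ^+ 2 -> d o y ^+ 2 = b ^+ 2 ->
  d x y ^+ 2 = (a - b) ^+ 2 \/ d x y ^+ 2 = (a + b) ^+ 2.
Proof.
move=> /degenerate_set3 oxy /eqP + /eqP; rewrite !eqf_sqr => a_ox b_oy.
have [|] : d x y ^+ 2 = (d o x - d o y) ^+ 2
        \/ d x y ^+ 2 = (d o x + d o y) ^+ 2.
- case: oxy => e; [left|right|left]; rewrite ?e -?e; ring.
- case/orP: a_ox => /eqP ->; case/orP: b_oy => /eqP -> ->;
    solve [left; ring | right; ring].
- case/orP: a_ox => /eqP ->; case/orP: b_oy => /eqP -> ->;
    solve [left; ring | right; ring].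
Qed.

(** The only possible common solution [t] of [t ^ 2 = d p x ^ 2] and
    [(t - d p q) ^ 2 = d q x ^ 2]: their difference is linear in [t]. *)
Definition coordinate (p q x : V) : R :=
  (d p x ^+ 2 - d q x ^+ 2 + d p q ^+ 2) / (2 * d p q).

Lemma coordinate_left p q : coordinate p q p = 0.
Proof.
by rewrite /coordinate dist_refl (dist_sym q p) expr0n /= sub0r addNr mul0r.
Qed.

Lemma coordinate_right p q : p != q -> coordinate p q q = d p q.
Proof.
move=> /dist_gt0 pq; rewrite /coordinate dist_refl; field; lra.
Qed.

Lemma coordinate_sqr p q x : p != q -> degenerate d [set p; q; x] ->
  d p x ^+ 2 = coordinate p q x ^+ 2 /\
  d q x ^+ 2 = (coordinate p q x - d p q) ^+ 2.
Proof.
move=> /dist_gt0 pq /degenerate_set3 pqx; rewrite /coordinate.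
by case: pqx => e; split; rewrite -e; field; lra.
Qed.

(** * Lines from two base points and a pair cover *)

Section Frame.
Variables (p q : V) (C : {set {set V}}).
Hypothesis pq : p != q.
Hypothesis frame_degenerate : forall T : {set V},
  #|T| = 3%N -> (p \in T) || (q \in T) -> degenerate d T.
Let g := coordinate p q.

Lemma frame_sqr x : d p x ^+ 2 = g x ^+ 2 /\ d q x ^+ 2 = (g x - d p q) ^+ 2.
Proof.
have [<-|px] := eqVneq p x.
  by rewrite /g coordinate_left dist_refl sub0r sqrrN (dist_sym q p).
have [<-|qx] := eqVneq q x.
  by rewrite /g coordinate_right // subrr dist_refl.
by apply/coordinate_sqr/frame_degenerate; rewrite ?card_set3 // !inE eqxx.
Qed.

(** If the distance of [x] and [y] is wrong, then it is a mirrored distance both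
    with the mirror at [p] and with the mirror at [q], and
    [(g x + g y) ^ 2 = (g x + g y - 2 * d p q) ^ 2] gives [g x + g y = d p q]. *)
Lemma frame_dichotomy x y : x \notin [set p; q] -> y \notin [set p; q] ->
    x != y ->
  d x y ^+ 2 = (g x - g y) ^+ 2 \/ (d x y = d p q /\ g x + g y = d p q).
Proof.
rewrite !inE !negb_or ![_ == p]eq_sym ![_ == q]eq_sym.
move=> /andP[px qx] /andP[py qy] xy.
have [[dpx dqx] [dpy dqy]] := (frame_sqr x, frame_sqr y).
have pxy : degenerate d [set p; x; y].
  by apply: frame_degenerate; rewrite ?card_set3 // !inE eqxx.
have qxy : degenerate d [set q; x; y].
  by apply: frame_degenerate; rewrite ?card_set3 // !inE eqxx orbT.
have [|dp] := degenerate_sqr_dist pxy dpx dpy; first by left.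
have [|dq] := degenerate_sqr_dist qxy dqx dqy.
  by move=> ->; left; ring.
right; have d_gt0 := dist_gt0 pq.
have S : g x + g y = d p q.
  have /eqP : 4 * d p q * (g x + g y - d p q) = 0 by rewrite dp in dq; lra.
  by rewrite mulf_eq0 => /orP[/eqP|/eqP]; lra.
split=> //; apply/eqP; rewrite -(@eqrXn2 _ 2) ?dist_ge0 //.
by rewrite dp S.
Qed.

(** A bad pair [x], [y], one in the second case of [frame_dichotomy], is
    incompatible with the degenerate triangle that [C] provides for it. *)
Lemma frame_cover_line :
    covers_pairs (~: [set p; q]) C -> (forall T, T \in C -> degenerate d T) ->
  isometric_to_subset_of_line d.
Proof.
move=> Ccov Cdeg; apply: (@coordinate_isometric g) => x y.
suff e : d x y ^+ 2 = (g x - g y) ^+ 2.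
  by apply/eqP; rewrite -(@eqrXn2 _ 2) ?dist_ge0 // real_normK ?num_real ?e.
have gp : g p = 0 by apply: coordinate_left.
have gq : g q = d p q by apply: coordinate_right.
have [xpq|xW] := boolP (x \in [set p; q]).
  have [px qx] := frame_sqr y.
  by move: xpq; rewrite !inE => /orP[]/eqP ->; rewrite ?px ?qx ?gp ?gq; ring.
have [ypq|yW] := boolP (y \in [set p; q]).
  have [py qy] := frame_sqr x.
  by move: ypq; rewrite !inE => /orP[]/eqP ->; rewrite (dist_sym x);
    rewrite ?py ?qy ?gp ?gq; ring.
have [<-|xy] := eqVneq x y; first by rewrite dist_refl subrr.
rewrite -in_setC in xW; rewrite -in_setC in yW.
have [z [zW zx zy /Cdeg xyz]] := Ccov x y xW yW xy.
rewrite !in_setC in xW yW zW.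
have [//|[dxy gxy]] := frame_dichotomy xW yW xy.
have d_gt0 := dist_gt0 pq.
have {}xyz : degenerate d [set z; x; y] by rewrite -setUA setUC.
have [dzx|[dzx gzx]] := frame_dichotomy zW xW zx;
    have [dzy|[dzy gzy]] := frame_dichotomy zW yW zy.
(* Both pairs are right: [d x y] is the mirrored distance with respect to [z],
   that is [d p q = |d p q - 2 * g z|], so [z] has the place of [p] or [q]. *)
- have [->|e] := degenerate_sqr_dist xyz dzx dzy; first by ring.
  have gyE : g y = d p q - g x by lra.
  have /eqP : g z * (g z - d p q) = 0 by rewrite dxy gyE in e; lra.
  rewrite mulf_eq0 subr_eq0 => /orP[] /eqP gz.
    have := (frame_sqr z).1; rewrite gz expr0n /= => /eqP.
    by rewrite sqrf_eq0 => /eqP/dist_eq0 pz; rewrite -pz !inE eqxx in zW.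
  have := (frame_sqr z).2; rewrite gz subrr expr0n /= => /eqP.
  by rewrite sqrf_eq0 => /eqP/dist_eq0 qz; rewrite -qz !inE eqxx orbT in zW.
(* Only [z], [y] is bad: [z] and [x] are the same mirror image of [y], at the
   right distance zero. *)
- have gzx : g z = g x by lra.
  move/eqP: dzx; rewrite gzx subrr expr0n sqrf_eq0 => /eqP/dist_eq0 zxE.
  by rewrite zxE eqxx in zx.
- have gzy : g z = g y by lra.
  move/eqP: dzy; rewrite gzy subrr expr0n sqrf_eq0 => /eqP/dist_eq0 zyE.
  by rewrite zyE eqxx in zy.
(* All three pairs are bad: the triangle is equilateral. *)
- by case/degenerate_set3: xyz; rewrite dxy dzx dzy; lra.
Qed.
End Frame.
End MetricLine.

(** * Anchors from pair covers *)

Lemma pair_cover_anchor (R : realType) (V : finType) (p q : V)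
    (C : {set {set V}}) : p != q -> (forall T, T \in C -> #|T| = 3%N) ->
    covers_pairs (~: [set p; q]) C ->
  anchor R ([set T : {set V} | (#|T| == 3%N) && (p \in T)]
    :|: [set T : {set V} | (#|T| == 3%N) && (q \in T)] :|: C).
Proof.
move=> pq C3 Ccov; split=> [T|d d_metric Adeg].
  by rewrite !inE -orbA => /or3P[/andP[/eqP]|/andP[/eqP]|/C3].
apply: (frame_cover_line d_metric pq _ Ccov) => [T T3 pqT|T TC].
  by apply: Adeg; rewrite !inE T3 eqxx /=; case/orP: pqT => ->; rewrite ?orbT.
by apply: Adeg; rewrite !inE TC orbT.
Qed.

Theorem theorem4 (R : realType) (n : nat) (n_gt0 : (0 < n)%N) (n_neq4 : n <> 4%N)
    (V : finType) (cardV : #|V| = n) :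
  exists A : {set {set V}},
    anchor R A /\ (#|A|%:R < 7%:R / 6%:R * n%:R ^+ 2 :> R).
Proof.
have [n_le1|n_gt1] := leqP n 1%N.
  exists set0; split; last first.
    by rewrite cards0 mulr_gt0 ?divr_gt0 ?exprn_gt0 ?ltr0n.
  split=> [T|d d_metric _]; first by rewrite inE.
  rewrite -cardV in n_le1; apply: (@coordinate_isometric _ _ _ d_metric (fun=> 0)).
  move=> x y; rewrite (card_le1_eqP n_le1 x y) // subrr normr0.
  by rewrite (dist_refl d_metric).
rewrite -cardV in n_gt1; have /card_gt1P[p [q [_ _ pq]]] := n_gt1.
have cardW : #|~: [set p; q]| = (n - 2)%N by rewrite cardsCs setCK cards2 pq cardV.
have [|C [C3 Ccov Cle]] := @pair_cover_exists V (~: [set p; q]).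
  by rewrite cardW; apply/eqP; lia.
eexists; split; first exact: pair_cover_anchor pq C3 Ccov.
set A := (X in #|X|).
suff A_lt : (6 * #|A| < 7 * n ^ 2)%N.
  have : 6 * #|A|%:R < 7 * n%:R ^+ 2 :> R.
    by rewrite -natrX -!natrM ltr_nat.
  by lra.
have [m nE] : exists m, n = m.+2 by exists n.-2; lia.
have bin k : (2 * 'C(k, 2) = k * k.-1)%N.
  by rewrite mulnC -[X in (_ * X)%N]/(2`!) bin_ffact ffactnS ffactn1.
have A_le : (#|A| <= 2 * 'C(m.+1, 2) + #|C|)%N.
  have at_le x := card_triples_at V x; rewrite cardV nE in at_le.
  apply: leq_trans (leq_card_setU _ _).1 _; rewrite leq_add2r mul2n -addnn.
  by apply: leq_trans (leq_card_setU _ _).1 _; apply: leq_add.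
rewrite cardW nE !subSS subn0 in Cle.
have := leq_mul (leqnn m) (leq_pred m).
have := bin m; have /= := bin m.+1; rewrite nE -mulnn.
move: #|A| #|C| 'C(m.+1, 2) 'C(m, 2) (m * m.-1)%N A_le Cle => *; lia.
Qed.
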